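(* Let $A$ be a C$^*$-algebra and let $a, b \in A_{sa}$. (1) There exists a unique $c \in A_{sa}$ such that (a) $c \le a$ and $c \le b$; and (b) $(a - c) \perp^a (b - c)$. (2) There exists a unique $d \in A_{sa}$ such that (a) $a \le d$ and $b \le d$; and (b) $(d - a) \perp^a (d - b)$.
   Context: $A_{sa}$ denotes the set of self-adjoint elements of the C$^*$-algebra $A$ (not assumed unital), $A^+$ its cone of positive elements, and $x \le y$ for $x, y \in A_{sa}$ means $y - x \in A^+$. For $x, y \in A$, $x$ is algebraically orthogonal to $y$, written $x \perp^a y$, if $x y^* = 0 = x^* y$; for self-adjoint $x, y$ this means $xy = 0$. *)

(* Defs.v *)
From HB Require Import structures.
From mathcomp Require Import all_boot all_order all_algebra.
From mathcomp Require Import all_classical all_reals all_analysis.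
From mathcomp Require Import complex.

Set Implicit Arguments.
Unset Strict Implicit.
Unset Printing Implicit Defensive.
Import Order.TTheory GRing.Theory Num.Theory.
Import numFieldNormedType.Exports.

Local Open Scope ring_scope.
Local Open Scope complex_scope.

Reserved Notation "x ** y" (at level 40, left associativity).
Reserved Notation "x <=* y" (at level 70, no associativity).

(* C*-algebras over the complex numbers R[i], with R : realType, built on a
   Banach space.  No unit is assumed, so the product cannot come from the unital
   ring structures of MathComp and is part of this mixin.
   The norm of a normed module over R[i] takes its values in R[i]; they are
   nonnegative, hence real. *)
HB.mixin Record isCStarAlgebra (R : realType) A
    of CompleteNormedModule R[i] A := {
  cmul : A -> A -> A;
  star : A -> A;
  cmulA : associative cmul;
  cmulDl : left_distributive cmul +%R;
  cmulDr : right_distributive cmul +%R;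
  cscalerAl : forall (k : R[i]) (x y : A), k *: cmul x y = cmul (k *: x) y;
  cscalerAr : forall (k : R[i]) (x y : A), k *: cmul x y = cmul x (k *: y);
  starK : involutive star;
  starD : {morph star : x y / x + y};
  starZ : forall (k : R[i]) (x : A), star (k *: x) = Num.conj k *: star x;
  starM : forall x y : A, star (cmul x y) = cmul (star y) (star x);
  ler_norm_cmul : forall x y : A, `|cmul x y| <= `|x| * `|y|;
  normr_cstar : forall x : A, `|cmul (star x) x| = `|x| ^+ 2
}.

#[short(type="cstarAlgType")]
HB.structure Definition CStarAlgebra (R : realType) :=
  {A of CompleteNormedModule R[i] A & isCStarAlgebra R A}.

Notation "x ** y" := (cmul x y) : ring_scope.

Section CStarAlgebraNotions.
Variables (R : realType) (A : cstarAlgType R).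
Implicit Types x y : A.

Definition self_adjoint x : Prop := star x = x.

(* A^+ = { y^* y | y in A }, which needs no spectrum, hence no unitization. *)
Definition cpositive x : Prop := exists y, x = star y ** y.

Definition cle x y : Prop := cpositive (y - x).

Definition alg_orth x y : Prop := x ** star y = 0 /\ star x ** y = 0.

End CStarAlgebraNotions.

Notation "x <=* y" := (cle x y) : ring_scope.

(* Main.v *)
Require Import Defs.
From HB Require Import structures.
From mathcomp Require Import all_boot all_order all_algebra.
From mathcomp Require Import all_classical all_reals all_analysis.
From mathcomp Require Import complex.
From mathcomp Require Import lra.

Import Order.TTheory GRing.Theory Num.Theory.
Import numFieldNormedType.Exports.

(** Put p = a - c and q = b - c.  The conditions on c say exactly that p and q
    are positive, that p ** q = 0 and that p - q = a - b, so the first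
    claim asserts that the self-adjoint element h = a - b has one and only one
    Jordan decomposition into orthogonal positive parts; the second claim is the
    first for - a and - b.

    Classically p and q are the positive and negative parts of h in the
    functional calculus.  Here the spectrum is replaced by a norm condition:
    [spos x] says that x is self-adjoint and that 1 - t x is a contraction for
    some real t > 0, where 1 - t x acts on the algebra by left multiplication, so
    that no unit has to be adjoined.  Such elements form a convex cone almost
    by definition.  The proof rests on four facts.

    - Squares of self-adjoint elements are in the cone ([spos_sqr]).  From
      1 + h^2 = (1 - i h)(1 + i h) one gets |z| <= |(1 + h^2) z|, hence
      |(1 - h^2) z| <= |(1 - h^4) z| <= |(1 - h^8) z| <= ..., which
      tends to |z| when |h| < 1.
    - Elements of the cone have square roots in the cone, commuting with
      whatever commutes with the element ([spos_sqrt]).  These are limits of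
      a quadratic iteration, dominated by the same iteration for
      numbers.  They are unique ([spos_sqr_inj]), and they even intertwine:
      s^2 w = w t^2 implies s w = w t ([spos_sqr_intertwine]).
    - With s the root of h^2, the elements (s + h)/2 and (s - h)/2 are
      orthogonal with difference h; comparing s with the sum of the roots of
      their squares shows that they lie in the cone ([jordan_exists]).
    - Every star y ** y is in the cone ([spos_starM], the theorem of Kelley,
      Vaught and Kaplansky).  So positivity of p and q means membership in the
      cone, and uniqueness follows: (p + q)^2 = (p - q)^2 = h^2, so that p + q
      is the root of h^2 and p = (|h| + h)/2. *)

Local Open Scope ring_scope.

(** * Algebra and topology of a C*-algebra *)

Section Algebra.
Set Implicit Arguments.
Unset Strict Implicit.
Unset Printing Implicit Defensive.
Local Open Scope complex_scope.
Variables (R : realType) (A : cstarAlgType R).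
Implicit Types (x y z w s t h p q : A) (c : R).

Lemma cmulNl x y : (- x) ** y = - (x ** y).
Proof. by rewrite -scaleN1r -cscalerAl scaleN1r. Qed.

Lemma cmulNr x y : x ** (- y) = - (x ** y).
Proof. by rewrite -scaleN1r -cscalerAr scaleN1r. Qed.

Lemma cmulBl x y z : (x - y) ** z = x ** z - y ** z.
Proof. by rewrite cmulDl cmulNl. Qed.

Lemma cmulBr x y z : x ** (y - z) = x ** y - x ** z.
Proof. by rewrite cmulDr cmulNr. Qed.

Lemma cmul0l x : 0 ** x = 0.
Proof. by rewrite -(subrr x) cmulBl !subrr. Qed.

Lemma cmul0r x : x ** 0 = 0.
Proof. by rewrite -(subrr x) cmulBr !subrr. Qed.

Lemma starN x : star (- x) = - star x.
Proof. by rewrite -scaleN1r starZ rmorphN rmorph1 scaleN1r. Qed.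

Lemma starB x y : star (x - y) = star x - star y.
Proof. by rewrite starD starN. Qed.

Lemma star0 : star (0 : A) = 0.
Proof. by rewrite -(subrr 0) starB !subrr. Qed.

Lemma starZr c x : star (c%:C *: x) = c%:C *: star x.
Proof. by rewrite starZ conj_Creal//; apply/complex_realP; exists c. Qed.

(** The norm of the algebra takes values in R[i]; its real part lives in an
    ordered field, where inequalities can be solved. *)
Definition rnorm x : R := complex.Re `|x|.

Lemma normr_rnorm x : `|x| = (rnorm x)%:C.
Proof. by rewrite RRe_real// normr_real. Qed.

Lemma rnorm_ge0 x : 0 <= rnorm x.
Proof. by rewrite -ler0c -normr_rnorm. Qed.

Lemma rnorm_eq0 x : rnorm x = 0 -> x = 0.
Proof. by move=> x0; apply/eqP; rewrite -normr_eq0 normr_rnorm x0. Qed.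

Lemma rnorm0 : rnorm 0 = 0.
Proof. by rewrite /rnorm normr0. Qed.

Lemma rnormD x y : rnorm (x + y) <= rnorm x + rnorm y.
Proof.
by rewrite -lecR rmorphD /= -!normr_rnorm ler_normD.
Qed.

Lemma rnormN x : rnorm (- x) = rnorm x.
Proof. by rewrite /rnorm normrN. Qed.

Lemma rnormB x y : rnorm (x - y) <= rnorm x + rnorm y.
Proof. by rewrite -(rnormN y) rnormD. Qed.

Lemma rnormM x y : rnorm (x ** y) <= rnorm x * rnorm y.
Proof. by rewrite -lecR rmorphM /= -!normr_rnorm ler_norm_cmul. Qed.

Lemma rnormZ c x : rnorm (c%:C *: x) = `|c| * rnorm x.
Proof.
rewrite /rnorm normrZ normc_def /= expr0n /= addr0 sqrtr_sqr normr_rnorm.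
by rewrite -rmorphM.
Qed.

Lemma rnorm_starM x : rnorm (star x ** x) = rnorm x ^+ 2.
Proof. by rewrite /rnorm normr_cstar normr_rnorm -rmorphXn. Qed.

Lemma rnorm_star x : rnorm (star x) = rnorm x.
Proof.
suff le y : rnorm y <= rnorm (star y).
  by apply/eqP; rewrite eq_le le andbT -{2}(starK x) le.
have [->|y0] := eqVneq (rnorm y) 0; first exact: rnorm_ge0.
have := rnormM (star y) y; rewrite rnorm_starM expr2 ler_pM2r//.
by rewrite lt_neqAle eq_sym y0 rnorm_ge0.
Qed.

Lemma cstar_eq0 x : star x ** x = 0 -> x = 0.
Proof.
move=> x0; apply: rnorm_eq0; apply/eqP.
by rewrite -sqrf_eq0 -rnorm_starM x0 rnorm0.
Qed.

Lemma scale_half x : (2^-1 : R)%:C *: (x + x) = x.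
Proof.
rewrite -[x in x + x]scale1r -scalerDl scalerA -[1 : R[i]]/((1 : R)%:C).
by rewrite -rmorphD -rmorphM mulVf ?scale1r// pnatr_eq0.
Qed.

Lemma rnorm_dbl x : rnorm (x + x) = 2 * rnorm x.
Proof.
rewrite -{3}(scale_half x) rnormZ ger0_norm ?invr_ge0//.
by rewrite mulrA mulfV ?mul1r// pnatr_eq0.
Qed.

Lemma saD x y : self_adjoint x -> self_adjoint y -> self_adjoint (x + y).
Proof. by rewrite /self_adjoint starD => -> ->. Qed.

Lemma saN x : self_adjoint x -> self_adjoint (- x).
Proof. by rewrite /self_adjoint starN => ->. Qed.

Lemma saB x y : self_adjoint x -> self_adjoint y -> self_adjoint (x - y).
Proof. by move=> ? ?; apply/saD => //; apply/saN. Qed.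

Lemma saZ c x : self_adjoint x -> self_adjoint (c%:C *: x).
Proof. by rewrite /self_adjoint starZr => ->. Qed.

Lemma sa_sqr x : self_adjoint x -> self_adjoint (x ** x).
Proof. by rewrite /self_adjoint starM => ->. Qed.

Lemma sa_comm x y : self_adjoint x -> self_adjoint y -> x ** y = y ** x ->
  self_adjoint (x ** y).
Proof. by rewrite /self_adjoint starM => -> ->. Qed.

Lemma sa_sqr_eq0 x : self_adjoint x -> x ** x = 0 -> x = 0.
Proof. by move=> sx xx; apply: cstar_eq0; rewrite sx. Qed.

Local Open Scope classical_set_scope.

Lemma cvg_rnormP (a : nat -> A) x :
  a @ \oo --> x <-> rnorm (x - a n) @[n --> \oo] --> (0 : R).
Proof.
split => [/cvgrPdist_lt ax|/cvgrPdist_lt ax].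
- apply/cvgrPdist_lt => e e0; have /ax : 0 < e%:C by rewrite ltcR.
  apply: filterS => n; rewrite normr_rnorm ltcR sub0r normrN ger0_norm//.
  exact: rnorm_ge0.
- apply/cvgrPdist_lt => e e0.
  have eE : e = (complex.Re e)%:C by rewrite RRe_real// gtr0_real.
  have /ax : 0 < complex.Re e by rewrite -ltcR -eE.
  apply: filterS => n; rewrite eE normr_rnorm ltcR sub0r normrN ger0_norm//.
  exact: rnorm_ge0.
Qed.

Lemma cvg_rnorm_le (a : nat -> A) (f : nat -> R) x :
  (forall n, rnorm (x - a n) <= f n) -> f @ \oo --> (0 : R) -> a @ \oo --> x.
Proof.
move=> af f0; apply/cvg_rnormP; apply: (squeeze_cvgr _ (cvg_cst 0) f0).
by apply: nearW => n; rewrite rnorm_ge0 af.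
Qed.

Lemma cvg_rnorm (a : nat -> A) x : a @ \oo --> x ->
  rnorm (a n) @[n --> \oo] --> rnorm x.
Proof.
move=> /cvg_rnormP ax; apply/subr_cvg0; apply/norm_cvg0P.
apply: (squeeze_cvgr _ (cvg_cst 0) ax).
apply: nearW => n /=; rewrite normr_ge0/= ler_norml; apply/andP; split.
  by have := rnormB (a n) (a n - x); rewrite subKr -(rnormN (a n - x)) opprB; lra.
by have := rnormB x (x - a n); rewrite subKr; lra.
Qed.

Lemma cvg_star (a : nat -> A) x : a @ \oo --> x ->
  star (a n) @[n --> \oo] --> star x.
Proof.
move=> /cvg_rnormP ax; apply: cvg_rnorm_le ax => n.
by rewrite -starB rnorm_star.
Qed.

Lemma cvg_cmul (a b : nat -> A) x y : a @ \oo --> x -> b @ \oo --> y ->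
  a n ** b n @[n --> \oo] --> x ** y.
Proof.
move=> ax b_y; apply: (@cvg_rnorm_le _
    (fun n => rnorm (x - a n) * rnorm y + rnorm (a n) * rnorm (y - b n))).
  move=> n; rewrite (_ : _ - _ = (x - a n) ** y + a n ** (y - b n)).
    by apply: (le_trans (rnormD _ _)); apply: lerD; exact: rnormM.
  by rewrite cmulBl cmulBr addrA subrK.
rewrite -[X in _ --> X](_ : 0 * rnorm y + rnorm x * 0 = 0); last first.
  by rewrite mul0r mulr0 addr0.
apply: cvgD; apply: cvgM;
  [exact/cvg_rnormP|exact: cvg_cst|exact: cvg_rnorm|exact/cvg_rnormP].
Qed.

Lemma cvg_eq (a : nat -> A) x y :
  a @ \oo --> x -> a @ \oo --> y -> x = y.
Proof. by apply: cvg_unique; exact: norm_hausdorff. Qed.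

Lemma cvg_scale (f : nat -> R) (a : nat -> A) c x :
  f @ \oo --> c -> a @ \oo --> x ->
  (f n)%:C *: a n @[n --> \oo] --> c%:C *: x.
Proof.
move=> fc ax; apply: (@cvg_rnorm_le _
    (fun n => `|c - f n| * rnorm x + `|f n| * rnorm (x - a n))).
  move=> n; rewrite (_ : _ - _ = (c - f n)%:C *: x + (f n)%:C *: (x - a n)).
    by apply: (le_trans (rnormD _ _)); rewrite !rnormZ.
  by rewrite rmorphB scalerBl scalerBr addrA subrK.
rewrite -[X in _ --> X](_ : 0 * rnorm x + `|c| * 0 = 0); last first.
  by rewrite mul0r mulr0 addr0.
apply: cvgD; apply: cvgM; [|exact: cvg_cst|exact: cvg_norm|exact/cvg_rnormP].
by rewrite -(@normr0 _ R) -(subrr c); apply: cvg_norm; apply: cvgB => //;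
  exact: cvg_cst.
Qed.

(** Telescoping: the distance of a m to a n is at most l n - l m <= l n when
    n <= m, so that completeness applies. *)
Lemma cvg_of_rnorm_step (a : nat -> A) (l : nat -> R) :
  (forall n, rnorm (a n.+1 - a n) <= l n - l n.+1) -> l @ \oo --> (0 : R) ->
  cvgn a.
Proof.
move=> al l0.
have am n k : rnorm (a (n + k)%N - a n) <= l n - l (n + k)%N.
  elim: k => [|k IH]; first by rewrite addn0 !subrr rnorm0.
  rewrite addnS; have := rnormD (a (n + k).+1 - a (n + k)%N) (a (n + k)%N - a n).
  by rewrite subrKA; move: (al (n + k)%N) IH; lra.
have l_ge0 n : 0 <= l n.
  rewrite -(cvg_lim _ l0)//; apply: nonincreasing_cvgn_ge; last exact: cvgP l0.
  apply/nonincreasing_seqP => k.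
  by rewrite -subr_ge0; apply: le_trans (al k); exact: rnorm_ge0.
apply/cauchy_cvgP; apply: cauchy_exP => e e0.
have eE : e = (complex.Re e)%:C by rewrite RRe_real// gtr0_real.
have e0' : 0 < complex.Re e by rewrite -ltcR -eE.
have [N _ lN] : \forall n \near \oo, l n < complex.Re e.
  exact: (cvgr_lt 0 l0).
exists (a N); rewrite /nbhs/=; exists N => // n /= Nn.
rewrite -ball_normE /= eE distrC normr_rnorm ltcR -(subnKC Nn).
apply: (le_lt_trans (am _ _)).
by have := lN N (leqnn _); move: (l_ge0 (N + (n - N))%N) => /=; lra.
Qed.

End Algebra.

(** * The cone of spectrally positive elements *)

Section Positivity.
Set Implicit Arguments.
Unset Strict Implicit.
Unset Printing Implicit Defensive.
Local Open Scope complex_scope.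
Local Open Scope classical_set_scope.
Variables (R : realType) (A : cstarAlgType R).
Implicit Types (x y z w s t h p q : A) (c : R).

(** The cross terms cancel because conj e = - e: both 1 + i h and 1 - i h
    are square roots of 1 + h^2 in the sense of y |-> star y ** y, and
    therefore have the same norm on every z. *)
Lemma star_sqr_addi (e : R[i]) h z : Num.conj e = - e -> e * e = -1 ->
  self_adjoint h ->
  star (z + e *: (h ** z)) ** (z + e *: (h ** z)) =
  star z ** z + star (h ** z) ** (h ** z).
Proof.
move=> eJ e2 sh; rewrite starD starZ eJ starM sh !cmulDl !cmulDr.
rewrite -!cscalerAl -!cscalerAr scalerA mulNr e2 opprK scale1r !cmulA.
by rewrite addrA scaleNr addrK.
Qed.

Lemma conjCiN : Num.conj (- 'i%R) = - - 'i%R :> R[i].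
Proof. by rewrite rmorphN /= conjCi. Qed.

Lemma rnorm_subi h z : self_adjoint h ->
  rnorm (z + - 'i%R *: (h ** z)) = rnorm (z + 'i%R *: (h ** z)).
Proof.
move=> sh; apply/eqP; rewrite -(@eqrXn2 _ 2) ?rnorm_ge0// -!rnorm_starM.
by rewrite !star_sqr_addi// ?conjCi ?conjCiN ?mulrNN -?expr2 ?sqrCi.
Qed.

(** 2 z is the sum of (1 + i h) z and (1 - i h) z, which have equal norms. *)
Lemma rnorm_le_addi h z : self_adjoint h ->
  rnorm z <= rnorm (z + 'i%R *: (h ** z)).
Proof.
move=> sh; have := rnormD (z + 'i%R *: (h ** z)) (z + - 'i%R *: (h ** z)).
rewrite rnorm_subi// scaleNr addrACA subrr addr0 rnorm_dbl; lra.
Qed.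

(** 1 + h^2 = (1 - i h)(1 + i h), and neither factor decreases norms. *)
Lemma rnorm_le_addsqr h z : self_adjoint h ->
  rnorm z <= rnorm (z + (h ** h) ** z).
Proof.
move=> sh; apply: (le_trans (rnorm_le_addi z sh)).
set v := z + _; apply: (le_trans (rnorm_le_addi v sh)).
rewrite -rnorm_subi// /v cmulDr scalerDr -cscalerAr scalerA mulNr -expr2 sqrCi.
by rewrite opprK scale1r scaleNr addrA addrK cmulA.
Qed.

(** 1 - h^4 = (1 + h^2)(1 - h^2). *)
Lemma rnorm_subsqr_le h z : self_adjoint h ->
  rnorm (z - (h ** h) ** z) <= rnorm (z - ((h ** h) ** (h ** h)) ** z).
Proof.
move=> sh; apply: (le_trans (rnorm_le_addsqr _ sh)).
by rewrite cmulBr addrA subrK cmulA.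
Qed.

(** 1 - x is a contraction; for self-adjoint x this says that the spectrum of x
    lies in the interval [0, 2]. *)
Definition spos1 x := self_adjoint x /\ forall z, rnorm (z - x ** z) <= rnorm z.

(** Iterating [rnorm_subsqr_le] replaces h^2 by arbitrarily high powers of h,
    whose norms tend to 0 because |h| < 1. *)
Lemma spos1_sqr h : self_adjoint h -> rnorm h <= 2^-1 -> spos1 (h ** h).
Proof.
move=> sh h2; split => [|z]; first exact: sa_sqr.
pose g n := iter n (fun x => x ** x) h.
have sg n : self_adjoint (g n) by elim: n => // n IH; exact: sa_sqr.
have gn n : rnorm (g n) <= 2^-1 ^+ n.+1.
  elim: n => [|n IH]; first by rewrite expr1.
  apply: (le_trans (rnormM _ _)); rewrite exprS.
  apply: ler_pM; rewrite ?rnorm_ge0//.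
  by apply: (le_trans IH); rewrite exprS ler_piMr ?invr_ge0//
    exprn_ile1// ?invr_ge0// invf_le1 ?ler1n.
have step n : rnorm (z - g 1%N ** z) <= rnorm (z - g n.+1 ** z).
  elim: n => // n IH; apply: (le_trans IH); exact: rnorm_subsqr_le.
have lim : rnorm z + 2^-1 ^+ n.+2 * rnorm z @[n --> \oo] --> rnorm z.
  rewrite -[X in _ --> X](_ : rnorm z + 0 * rnorm z = _); last first.
    by rewrite mul0r addr0.
  apply: cvgD; first exact: cvg_cst.
  apply: cvgM; last exact: cvg_cst.
  have := @cvg_expr R 2^-1; rewrite ger0_norm ?invr_ge0// invf_lt1 ?ltr1n//.
  move=> /(_ isT); rewrite -(cvg_shiftn 2).
  by under eq_fun do rewrite addn2.
apply: (cvgr_to_ge lim); apply: nearW => n /=.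
apply: (le_trans (step n)); apply: (le_trans (rnormB _ _)).
rewrite lerD2l; apply: (le_trans (rnormM _ _)).
by rewrite ler_wpM2r ?rnorm_ge0.
Qed.

Lemma spos10 : spos1 0.
Proof. by split => [|z]; [exact: star0|rewrite cmul0l subr0]. Qed.

Lemma spos1_convex x y c : 0 <= c <= 1 -> spos1 x -> spos1 y ->
  spos1 (c%:C *: x + (1 - c)%:C *: y).
Proof.
move=> /andP[c0 c1] [sx x1] [sy y1]; split => [|z].
  by apply: saD; exact: saZ.
rewrite (_ : _ - _ = c%:C *: (z - x ** z) + (1 - c)%:C *: (z - y ** z)).
  apply: (le_trans (rnormD _ _)); rewrite !rnormZ !ger0_norm ?subr_ge0//.
  have := ler_wpM2l c0 (x1 z).
  by have := ler_wpM2l (_ : 0 <= 1 - c) (y1 z); rewrite subr_ge0 => /(_ c1); lra.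
rewrite !scalerBr addrACA -scalerDl -rmorphD (addrC c) subrK rmorph1 scale1r.
by rewrite cmulDl -!cscalerAl opprD.
Qed.

Lemma spos1_shrink x c : 0 <= c <= 1 -> spos1 x -> spos1 (c%:C *: x).
Proof.
move=> c01 x1; have := spos1_convex c01 x1 spos10.
by rewrite scaler0 addr0.
Qed.

Definition spos x := exists2 c : R, 0 < c & spos1 (c%:C *: x).

Lemma scaleCK c x : c != 0 -> c^-1%:C *: (c%:C *: x) = x.
Proof. by move=> c0; rewrite scalerA -rmorphM mulVf// rmorph1 scale1r. Qed.

Lemma spos_sa x : spos x -> self_adjoint x.
Proof.
move=> [c c0 [sx _]]; rewrite -(@scaleCK c x) ?gt_eqF//; exact: saZ.
Qed.

(** A scaling factor valid for x can be decreased, so that two elements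
    can be normalized together. *)
Lemma spos_common x y : spos x -> spos y ->
  exists2 c : R, 0 < c & spos1 (c%:C *: x) /\ spos1 (c%:C *: y).
Proof.
move=> [c c0 xc] [d d0 yd].
have h (c' d' : R) w : 0 < c' -> 0 < d' -> c' <= d' -> spos1 (d'%:C *: w) ->
    spos1 (c'%:C *: w).
  move=> c'0 d'0 cd wd.
  have -> : c'%:C *: w = (c' / d')%:C *: (d'%:C *: w).
    by rewrite scalerA -rmorphM mulfVK// gt_eqF.
  apply: spos1_shrink => //; rewrite ler_pdivrMr// mul1r cd andbT.
  exact: divr_ge0 (ltW _) (ltW _).
by case: (leP c d) => [cd|/ltW dc]; [exists c|exists d] => //; split => //;
  [apply: h yd|apply: h xc].
Qed.

Lemma spos_add x y : spos x -> spos y -> spos (x + y).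
Proof.
move=> px py; have [c c0 [xc yc]] := spos_common px py.
exists (2^-1 * c); first by rewrite mulr_gt0 ?invr_gt0.
rewrite rmorphM -scalerA scalerDr scalerDr.
have {2}-> : (2^-1 : R) = 1 - 2^-1 by lra.
by apply: spos1_convex => //; lra.
Qed.

Lemma spos_scale x c : 0 < c -> spos x -> spos (c%:C *: x).
Proof.
move=> c0 [d d0 xd]; exists (d / c); first exact: divr_gt0.
by rewrite scalerA -rmorphM mulfVK ?gt_eqF.
Qed.

Lemma spos_sqr h : self_adjoint h -> spos (h ** h).
Proof.
move=> sh; pose k := (2 * (rnorm h + 1))^-1.
have k0 : 0 < k by rewrite invr_gt0 mulr_gt0// ltr_wpDl ?rnorm_ge0.
exists (k * k); first exact: mulr_gt0.
rewrite rmorphM -scalerA cscalerAl cscalerAr; apply: spos1_sqr.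
  exact: saZ.
rewrite rnormZ gtr0_norm// /k invfM -mulrA ler_piMr ?invr_ge0//.
by rewrite mulrC ler_pdivrMr ?ltr_wpDl ?rnorm_ge0// mul1r lerDl.
Qed.

End Positivity.

(** * Square roots *)

Section Sqrt.
Set Implicit Arguments.
Unset Strict Implicit.
Unset Printing Implicit Defensive.
Local Open Scope complex_scope.
Local Open Scope classical_set_scope.
Variables (R : realType) (A : cstarAlgType R).
Implicit Types (x y z w s t h p q : A) (c : R).

(** If y is the wanted root of x then v = 1 - y solves v = ((1 - x) + v^2)/2,
    which suggests the iteration v' = ((1 - x) + v^2)/2 from v = 0.  Since
    1 - x is a contraction, the norms of the iterates are bounded by the numbers
    u' = (1 + u^2)/2 from u = 0, which increase to 1. *)
Fixpoint sqrt_bound (n : nat) : R :=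
  if n is m.+1 then 2^-1 * (1 + sqrt_bound m ^+ 2) else 0.

Lemma sqrt_bound01 n : 0 <= sqrt_bound n <= 1.
Proof. by elim: n => [|n] /=; [rewrite lexx ler01|nra]. Qed.

Lemma sqrt_bound_le n : sqrt_bound n <= sqrt_bound n.+1.
Proof. by have := sqrt_bound01 n; rewrite /=; nra. Qed.

Lemma cvg_sqrt_bound : sqrt_bound @ \oo --> (1 : R).
Proof.
have ub : cvgn sqrt_bound.
  apply: nondecreasing_is_cvgn; first exact/nondecreasing_seqP/sqrt_bound_le.
  by exists 1 => _ [n _ <-]; have /andP[] := sqrt_bound01 n.
have /cvg_ex[l ul] := ub.
suff l1 : l = 1 by rewrite -l1.
have u'l : sqrt_bound n.+1 @[n --> \oo] --> 2^-1 * (1 + l * l).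
  apply: cvgM; first exact: cvg_cst.
  by apply: cvgD; [exact: cvg_cst|exact: cvgM].
have ll : l = 2^-1 * (1 + l * l).
  apply: (cvg_unique _ _ u'l) => //.
  by have := ul; rewrite -cvg_shiftS.
apply/eqP; rewrite -subr_eq0 -sqrf_eq0; apply/eqP; lra.
Qed.

(** The iterate v of the preceding comment has scalar part u, because 1 - x has
    scalar part 1; the element v = u - s then has its other part s in the
    algebra, and s obeys the recursion s' = (2 u s + x - s^2)/2.  As u tends to 1,
    s tends to 1 - v, the root of x. *)
Fixpoint sqrts x (n : nat) : A :=
  if n is m.+1 then
    (2^-1 : R)%:C *: ((sqrt_bound m)%:C *: (sqrts x m + sqrts x m)
                      + (x - sqrts x m ** sqrts x m))
  else 0.

(** The operator v_n = u_n - s_n applied to z. *)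
Let Y x n z := (sqrt_bound n)%:C *: z - sqrts x n ** z.

Let YB x n y z : Y x n (y - z) = Y x n y - Y x n z.
Proof. by rewrite /Y scalerBr cmulBr !opprB [LHS](AC (2*2) ((1*4)*(3*2))). Qed.

(** This is the iteration v' = ((1 - x) + v^2)/2, as an identity of operators. *)
Let YS x n z : Y x n.+1 z = (2^-1 : R)%:C *: (z - x ** z + Y x n (Y x n z)).
Proof.
rewrite YB /Y /=; set u := sqrt_bound n; set s := sqrts x n.
rewrite rmorphM -scalerA -cscalerAl -scalerBr; congr (_ *: _).
rewrite rmorphD rmorph1 scalerDl scale1r rmorphXn /= expr2 -scalerA.
rewrite cmulDl -cscalerAl cmulDl cmulBl -cscalerAr scalerDr -cmulA.
rewrite !opprD ?opprB !addrA.
by rewrite [LHS](AC 6 (1*5*2*3*4*6)).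
Qed.

Let Y_le x n z : spos1 x -> rnorm (Y x n z) <= sqrt_bound n * rnorm z.
Proof.
move=> [_ x1]; elim: n z => [|n IH] z.
  by rewrite /Y /= scale0r cmul0l subrr rnorm0 mul0r.
rewrite YS rnormZ ger0_norm ?invr_ge0// -mulrA ler_wpM2l ?invr_ge0//.
apply: (le_trans (rnormD _ _)); rewrite mulrDl mul1r; apply: lerD => //.
apply: (le_trans (IH _)); rewrite expr2 -mulrA; apply: ler_wpM2l => //.
by have /andP[] := sqrt_bound01 n.
Qed.

(** v'' - v' = (v'^2 - v^2)/2 = (v' (v' - v) + (v' - v) v)/2, so by induction the
    steps are bounded by (u'^2 - u^2)/2 = u'' - u'. *)
Let Y_step x n z : spos1 x ->
  rnorm (Y x n.+1 z - Y x n z) <= (sqrt_bound n.+1 - sqrt_bound n) * rnorm z.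
Proof.
move=> x1; elim: n z => [|n IH] z.
  by rewrite {2}/Y /= scale0r cmul0l !subrr !subr0; exact: (Y_le 1 _ x1).
have -> : Y x n.+2 z - Y x n.+1 z =
    (2^-1 : R)%:C *: (Y x n.+1 (Y x n.+1 z - Y x n z)
                      + (Y x n.+1 (Y x n z) - Y x n (Y x n z))).
  rewrite YS [in X in _ - X]YS -scalerBr; congr (_ *: _).
  by rewrite opprD addrACA subrr add0r (YB x n.+1 (Y x n.+1 z)) addrA subrK.
rewrite rnormZ ger0_norm ?invr_ge0//.
have /andP[u0 u1] := sqrt_bound01 n; have /andP[v0 v1] := sqrt_bound01 n.+1.
have := rnormD (Y x n.+1 (Y x n.+1 z - Y x n z)) (Y x n.+1 (Y x n z) - Y x n (Y x n z)).
have := Y_le n.+1 (Y x n.+1 z - Y x n z) x1.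
have := ler_wpM2l v0 (IH z).
have := IH (Y x n z).
have : 0 <= sqrt_bound n.+1 - sqrt_bound n by rewrite subr_ge0 sqrt_bound_le.
move=> d0; have := ler_wpM2l d0 (Y_le n z x1).
have -> : sqrt_bound n.+2 - sqrt_bound n.+1 =
   2^-1 * (sqrt_bound n.+1 ^+ 2 - sqrt_bound n ^+ 2) by rewrite /=; lra.
move: (sqrt_bound n.+1) (sqrt_bound n) (rnorm z) => v u r; nra.
Qed.

(** The C*-identity makes left multiplication isometric: test on star x. *)
Lemma rnorm_le_opnorm x c : 0 <= c ->
  (forall z, rnorm (x ** z) <= c * rnorm z) -> rnorm x <= c.
Proof.
move=> c0 /(_ (star x)); rewrite -{1}(starK x) rnorm_starM rnorm_star expr2.
have [->|x0] := eqVneq (rnorm x) 0; first by [].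
by rewrite ler_pM2r// lt_neqAle eq_sym x0 rnorm_ge0.
Qed.

(** s' - s = (u' - u) - (v' - v), and both differences are bounded by u' - u. *)
Lemma sqrts_step x n : spos1 x ->
  rnorm (sqrts x n.+1 - sqrts x n) <= 2 * (sqrt_bound n.+1 - sqrt_bound n).
Proof.
move=> x1; have d0 : 0 <= sqrt_bound n.+1 - sqrt_bound n.
  by rewrite subr_ge0 sqrt_bound_le.
apply: rnorm_le_opnorm; first exact: mulr_ge0.
move=> z; rewrite (_ : _ ** z =
  (sqrt_bound n.+1 - sqrt_bound n)%:C *: z - (Y x n.+1 z - Y x n z)).
  have := rnormB ((sqrt_bound n.+1 - sqrt_bound n)%:C *: z) (Y x n.+1 z - Y x n z).
  rewrite rnormZ ger0_norm//; have := Y_step n z x1; lra.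
have cancel (a b u v : A) : a - b = v - u - (v - a - (u - b)).
  by rewrite !opprB [RHS](AC (2*(2*2)) ((1*6)*(3*2)*(5*4)))/= !subrr !add0r.
by rewrite rmorphB scalerBl cmulBl /Y -cancel.
Qed.

Definition sqrt1 x : A := limn (sqrts x).

Lemma cvg_sqrts x : spos1 x -> sqrts x @ \oo --> sqrt1 x.
Proof.
move=> x1; apply: (@cvg_of_rnorm_step _ _ _ (fun n => 2 * (1 - sqrt_bound n))).
  by move=> n; apply: (le_trans (sqrts_step n x1)); lra.
rewrite -[X in _ --> X](_ : 2 * (1 - 1) = 0); last by rewrite subrr mulr0.
apply: cvgM; first exact: cvg_cst.
by apply: cvgB; [exact: cvg_cst|exact: cvg_sqrt_bound].
Qed.

(** The limit s satisfies s = (2 s + x - s^2)/2. *)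
Lemma sqrt1_sqr x : spos1 x -> sqrt1 x ** sqrt1 x = x.
Proof.
move=> x1; have sl := cvg_sqrts x1; set s := sqrt1 x in sl *.
have s'l : sqrts x n.+1 @[n --> \oo] -->
    (2^-1 : R)%:C *: ((1 : R)%:C *: (s + s) + (x - s ** s)).
  apply: cvg_scale; first exact: cvg_cst.
  apply: cvgD; first by apply: cvg_scale; [exact: cvg_sqrt_bound|exact: cvgD].
  by apply: cvgB; [exact: cvg_cst|exact: cvg_cmul].
have : s = (2^-1 : R)%:C *: ((1 : R)%:C *: (s + s) + (x - s ** s)).
  by apply: cvg_eq s'l; have := sl; rewrite -cvg_shiftS.
rewrite rmorph1 scale1r scalerDr scale_half -[X in X = _]addr0 => /addrI/esym.
move=> /eqP; rewrite scaler_eq0 subr_eq0 => /orP[|/eqP//].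
by rewrite (fmorph_eq0 (real_complex R)) invr_eq0 pnatr_eq0.
Qed.

Lemma sqrt1_spos1 x : spos1 x -> spos1 (sqrt1 x).
Proof.
move=> x1; have [sx _] := x1; have sl := cvg_sqrts x1; split => [|z].
  have ssa n : star (sqrts x n) = sqrts x n.
    elim: n => [|n IH] /=; first exact: star0.
    by rewrite starZr starD starZr starB starD starM IH sx.
  have := cvg_star sl; under eq_fun do rewrite ssa.
  by move=> /(cvg_eq sl)/esym.
have zl : z - sqrts x n ** z @[n --> \oo] --> z - sqrt1 x ** z.
  by apply: cvgB; [exact: cvg_cst|apply: cvg_cmul => //; exact: cvg_cst].
apply: (cvgr_to_le (cvg_rnorm zl)); apply: nearW => n /=.
have -> : z - sqrts x n ** z = (1 - sqrt_bound n)%:C *: z + Y x n z.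
  by rewrite /Y rmorphB rmorph1 scalerBl scale1r addrA subrK.
apply: (le_trans (rnormD _ _)); rewrite rnormZ ger0_norm.
  by have := Y_le n z x1; lra.
by rewrite subr_ge0; have /andP[] := sqrt_bound01 n.
Qed.

(** The roots are limits of polynomials in x and y with the same coefficients. *)
Lemma sqrt1_intertwine x y w : spos1 x -> spos1 y -> x ** w = w ** y ->
  sqrt1 x ** w = w ** sqrt1 y.
Proof.
move=> x1 y1 xw.
have sw n : sqrts x n ** w = w ** sqrts y n.
  elim: n => [|n IH] /=; first by rewrite cmul0l cmul0r.
  rewrite -cscalerAl -cscalerAr !cmulDl !cmulDr !cmulNl !cmulNr.
  by rewrite -cscalerAl -cscalerAr !cmulDl !cmulDr -!cmulA IH cmulA IH -cmulA xw.
have xl : sqrts x n ** w @[n --> \oo] --> sqrt1 x ** w.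
  by apply: cvg_cmul; [exact: cvg_sqrts|exact: cvg_cst].
have : sqrts x n ** w @[n --> \oo] --> w ** sqrt1 y.
  under eq_fun do rewrite sw.
  by apply: cvg_cmul; [exact: cvg_cst|exact: cvg_sqrts].
by move=> /(cvg_eq xl).
Qed.

End Sqrt.

(** * Uniqueness of square roots, and Jordan decomposition *)

Section Jordan.
Set Implicit Arguments.
Unset Strict Implicit.
Unset Printing Implicit Defensive.
Local Open Scope complex_scope.
Variables (R : realType) (A : cstarAlgType R).
Implicit Types (x y z u v w s t h p q : A) (c : R).

Lemma spos_sqrt x : spos x -> exists s, [/\ spos s, s ** s = x &
  forall w, x ** w = w ** x -> s ** w = w ** s].
Proof.
move=> [c c0 xc]; have [r r0 rc] : exists2 r : R, 0 < r & r * r * c = 1.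
  exists (Num.sqrt c)^-1; first by rewrite invr_gt0 sqrtr_gt0.
  by rewrite -invfM -expr2 sqr_sqrtr ?ltW// mulVf ?gt_eqF.
have sc := sqrt1_spos1 xc.
exists (r%:C *: sqrt1 (c%:C *: x)); split.
- by apply: spos_scale => //; exists 1; rewrite ?ltr01// rmorph1 scale1r.
- rewrite -cscalerAl -cscalerAr sqrt1_sqr// !scalerA -!rmorphM.
  by rewrite rc rmorph1 scale1r.
- move=> w xw; rewrite -cscalerAl -cscalerAr; congr (_ *: _).
  by apply: sqrt1_intertwine => //; rewrite -cscalerAl -cscalerAr xw.
Qed.

(** x^2 + y^2 is star z ** z for the normal element z = x + i y, so z = 0; the
    self-adjoint and skew-adjoint parts of z then vanish. *)
Lemma sum_sqr_eq0 x y : self_adjoint x -> self_adjoint y -> x ** y = y ** x ->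
  x ** x + y ** y = 0 -> x = 0 /\ y = 0.
Proof.
move=> sx sy xy xxyy.
suff key (u v : A) : self_adjoint u -> self_adjoint v -> u ** v = v ** u ->
    u ** u + v ** v = 0 -> v = 0.
  by split; [apply: (key y x) => //; rewrite addrC|apply: (key x y)].
move=> su sv uv uuvv.
have /eqP : u + 'i%R *: v = 0.
  apply: cstar_eq0; rewrite starD starZ conjCi su sv !cmulDl !cmulDr.
  rewrite -!cscalerAl -!cscalerAr scalerA mulNr -expr2 sqrCi opprK scale1r uv.
  by rewrite scaleNr addrA addrK.
rewrite addr_eq0 => /eqP uE.
have /eqP : u = - u by rewrite -{1}su uE starN starZ conjCi sv scaleNr.
rewrite -subr_eq0 opprK => /eqP u0.
have {}u0 : u = 0 by rewrite -(scale_half u) u0 scaler0.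
by apply: sa_sqr_eq0 => //; move: uuvv; rewrite u0 cmul0l add0r.
Qed.

(** Let d = s - t, and let r and r' be roots of s and t.  Then
    (r d)^2 + (r' d)^2 = (s + t) d^2 = (s^2 - t^2) d = 0, so r d = r' d = 0 and
    d^2 = s d - t d = 0. *)
Lemma spos_sqr_inj_comm s t : spos s -> spos t -> s ** t = t ** s ->
  s ** s = t ** t -> s = t.
Proof.
move=> ps pt st sstt.
have ss := spos_sa ps; have sat := spos_sa pt.
have [r [pr rr rc]] := spos_sqrt ps; have [r' [pr' rr' rc']] := spos_sqrt pt.
have sr := spos_sa pr; have sr' := spos_sa pr'.
set d := s - t; have sd : self_adjoint d by exact: saB.
have sdC : s ** d = d ** s by rewrite cmulBl cmulBr st.
have tdC : t ** d = d ** t by rewrite cmulBl cmulBr st.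
have rd := rc _ sdC; have r'd := rc' _ tdC.
have rr'C : r ** r' = r' ** r.
  by apply: rc; apply/esym/rc'.
have sqE u : u ** d = d ** u -> (u ** d) ** (u ** d) = ((u ** u) ** d) ** d.
  by move=> ud; rewrite -!cmulA (cmulA d u) -ud -!cmulA.
have [rd0 r'd0] : r ** d = 0 /\ r' ** d = 0.
  apply: sum_sqr_eq0; [exact: sa_comm|exact: sa_comm| |].
    by rewrite -!cmulA (cmulA d r') (cmulA d r) -rd -r'd !cmulA rr'C.
  have std : (s + t) ** d = 0.
    by rewrite /d cmulBr !cmulDl sstt st [t ** s + _]addrC subrr.
  by rewrite !sqE// rr rr' -cmulDl -cmulDl std cmul0l.
apply/eqP; rewrite -subr_eq0; apply/eqP/sa_sqr_eq0 => //.
by rewrite -/d {1}/d cmulBl -rr -rr' -!cmulA rd0 r'd0 !cmul0r subrr.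
Qed.

(** The root of s^2 built by iteration commutes with everything that commutes with
    s^2 = t^2, in particular with s and with t, so it equals both. *)
Lemma spos_sqr_inj s t : spos s -> spos t -> s ** s = t ** t -> s = t.
Proof.
move=> ps pt sstt; have [r [pr rr rc]] := spos_sqrt (spos_sqr (spos_sa ps)).
have root u : spos u -> u ** u = s ** s -> r = u.
  move=> pu uu; apply: spos_sqr_inj_comm => //; last by rewrite rr.
  by apply: rc; rewrite -uu cmulA.
by rewrite -(root s)// (root t).
Qed.

(** By uniqueness s and t are, up to a common scalar, the roots built by iteration
    from s^2 and t^2, and those inherit intertwining relations. *)
Lemma spos_sqr_intertwine s t w : spos s -> spos t ->
  (s ** s) ** w = w ** (t ** t) -> s ** w = w ** t.
Proof.
move=> ps pt ssw.
have [c c0 [sc tc]] := spos_common (spos_sqr (spos_sa ps)) (spos_sqr (spos_sa pt)).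
have root u : spos u -> spos1 (c%:C *: (u ** u)) ->
    sqrt1 (c%:C *: (u ** u)) = (Num.sqrt c)%:C *: u.
  move=> pu uc; have u1 := sqrt1_spos1 uc.
  apply: spos_sqr_inj.
  - by exists 1; rewrite ?ltr01// rmorph1 scale1r.
  - by apply: spos_scale => //; rewrite sqrtr_gt0.
  - rewrite sqrt1_sqr// -cscalerAl -cscalerAr scalerA -rmorphM -expr2.
    by rewrite sqr_sqrtr ?ltW.
have : sqrt1 (c%:C *: (s ** s)) ** w = w ** sqrt1 (c%:C *: (t ** t)).
  by apply: sqrt1_intertwine => //; rewrite -cscalerAl -cscalerAr ssw.
rewrite !root// -cscalerAl -cscalerAr => /(congr1 (fun y => (Num.sqrt c)^-1%:C *: y)).
by rewrite !scaleCK// gt_eqF// sqrtr_gt0.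
Qed.

Lemma spos_cpositive x : spos x -> cpositive x.
Proof.
by move=> px; have [s [ps <- _]] := spos_sqrt px; exists s; rewrite (spos_sa ps).
Qed.

(** With s the root of h^2, p and q are (s + h)/2 and (s - h)/2, and p q = 0 as
    s^2 = h^2.  Let p' and q' be the roots of p^2 and q^2.  All products across
    the two sides vanish, so (p' + q')^2 = p^2 + q^2 = s^2 and p' + q' = s = p + q.
    Multiplying by p gives p p' = p^2, whence (p - p')^2 = 0. *)
Lemma jordan_exists h : self_adjoint h -> exists p q,
  [/\ spos p, spos q, p ** q = 0 & h = p - q].
Proof.
move=> sh; have [s [ps ss sc]] := spos_sqrt (spos_sqr sh).
have sas := spos_sa ps; have shC : s ** h = h ** s by apply: sc; rewrite cmulA.
pose p := (2^-1 : R)%:C *: (s + h); pose q := (2^-1 : R)%:C *: (s - h).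
have sp : self_adjoint p by apply/saZ/saD.
have sq : self_adjoint q by apply/saZ/saB.
have pq : p ** q = 0.
  rewrite -cscalerAl -cscalerAr cmulDl !cmulBr ss shC.
  by rewrite [_ - _ + _]addrC addrA subrK subrr !scaler0.
have qp : q ** p = 0.
  by rewrite -sp -sq -starM pq star0.
have sE : s = p + q.
  by rewrite -scalerDr addrACA subrr addr0 scale_half.
have hE : h = p - q.
  by rewrite -scalerBr opprB addrC addrA subrK scale_half.
have [p' [pp' p'2 _]] := spos_sqrt (spos_sqr sp).
have [q' [pq' q'2 _]] := spos_sqrt (spos_sqr sq).
have sp' := spos_sa pp'; have sq' := spos_sa pq'.
have p'q : p' ** q = 0.
  apply: cstar_eq0; rewrite starM sp' sq -cmulA (cmulA p') p'2 -cmulA pq.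
  by rewrite !cmul0r.
have q'p : q' ** p = 0.
  apply: cstar_eq0; rewrite starM sq' sp -cmulA (cmulA q') q'2 -cmulA qp.
  by rewrite !cmul0r.
have pq'0 : p ** q' = 0 by rewrite -sp -sq' -starM q'p star0.
have p'q' : p' ** q' = 0.
  apply: cstar_eq0; rewrite starM sp' sq' -cmulA (cmulA p') p'2 -cmulA pq'0.
  by rewrite !cmul0r.
have q'p' : q' ** p' = 0 by rewrite -sq' -sp' -starM p'q' star0.
have sum : p + q = p' + q'.
  rewrite -sE; apply: spos_sqr_inj => //; first exact: spos_add.
  rewrite {1 2}sE !cmulDl !cmulDr pq qp p'q' q'p' p'2 q'2.
  by rewrite !addr0 !add0r.
have pp'E : p ** p' = p ** p.
  have := congr1 (cmul p) sum; rewrite !cmulDr pq pq'0 !addr0; by move=> ->.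
have p'pE : p' ** p = p ** p.
  by rewrite -[LHS]starK starM sp sp' pp'E (sa_sqr sp).
have pE : p = p'.
  apply/eqP; rewrite -subr_eq0; apply/eqP/sa_sqr_eq0; first exact: saB.
  by rewrite cmulBl !cmulBr pp'E p'pE p'2 !subrr.
have qE : q = q' by move: sum; rewrite -pE => /addrI.
by exists p, q; split => //; [rewrite pE|rewrite qE].
Qed.

(** Let q be the negative part of star y ** y and w = y q.  Then star w ** w = - t
    with t = q^3.  Writing w = a + i b with a and b self-adjoint,
    w ** star w = 2 a^2 + 2 b^2 - star w ** w, so v = w ** star w is in the cone.
    Since v w = - w t, we have v^2 w = w t^2, hence also v w = w t because v and t
    are in the cone.  Thus w t = 0 and t^2 = - star w ** w ** t = 0,
    hence q^3 = t = 0 and q = 0. *)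
Lemma spos_starM y : spos (star y ** y).
Proof.
have sh : self_adjoint (star y ** y) by rewrite /self_adjoint starM starK.
have [p [q [pp pq pq0 hE]]] := jordan_exists sh.
have sq := spos_sa pq.
suff q0 : q = 0 by rewrite hE q0 subr0.
have [r [pr rr rc]] := spos_sqrt pq.
have rq : r ** q = q ** r by apply: rc.
have sqr : self_adjoint (q ** r) by apply: sa_comm => //; exact: spos_sa.
(* t is q^3, written as a square to see that it is in the cone. *)
pose w := y ** q; pose t := (q ** r) ** (q ** r).
have pt : spos t by exact: spos_sqr.
have tE : t = (q ** q) ** q.
  by rewrite /t -{2}rq -!cmulA (cmulA r r) rr.
have wE : star w ** w = - t.
  rewrite /w starM sq -cmulA (cmulA (star y)) hE cmulBl pq0 sub0r cmulNr tE.
  by rewrite cmulA.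
have pv : spos (w ** star w).
  (* b is (w - star w)/(2 i), since i/2 = - 1/(2 i). *)
  pose a := (2^-1 : R)%:C *: (w + star w).
  pose b := (2^-1 : R)%:C *: ('i%R *: (star w - w)).
  have sa : self_adjoint a by apply: saZ; rewrite /self_adjoint starD starK addrC.
  have sb : self_adjoint b.
    apply: saZ; rewrite /self_adjoint starZ starB starK conjCi scaleNr -scalerN.
    by rewrite opprB.
  have -> : w ** star w = (a ** a + b ** b) + (a ** a + b ** b) + t.
    have ab : a ** a + b ** b =
        (2^-1 : R)%:C *: (w ** star w + star w ** w).
      have -> : (2^-1 : R)%:C *: (w ** star w + star w ** w) =
          (2^-1 * 2^-1 : R)%:C *: ((w ** star w + star w ** w) +
                                   (w ** star w + star w ** w)).
        by rewrite rmorphM -scalerA scale_half.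
      have -> : b ** b =
          - ((2^-1 * 2^-1 : R)%:C *: ((star w - w) ** (star w - w))).
        rewrite -!cscalerAl -!cscalerAr [in LHS](scalerA 'i%R) mulrC -!scalerA.
        by rewrite (scalerA 'i%R 'i%R) -expr2 sqrCi scaleN1r !scalerN rmorphM -scalerA.
      rewrite -cscalerAl -cscalerAr scalerA -rmorphM -scalerBr; congr (_ *: _).
      rewrite cmulBl !cmulBr cmulDl !cmulDr !opprB.
      rewrite [LHS](AC ((2*2)*(2*2)) (((2*3)*(5*7))*((1*6)*(4*8))))/=.
      by rewrite !subrr !addr0.
    by rewrite ab -scalerDr scale_half wE subrK.
  by do !apply: spos_add => //; apply: spos_sqr.
have vw : (w ** star w) ** w = w ** (- t) by rewrite -cmulA wE.
have vtw : (w ** star w) ** w = w ** t.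
  apply: spos_sqr_intertwine => //.
  by rewrite -cmulA vw cmulA vw -cmulA cmulNl !cmulNr opprK.
have wt : w ** t = 0.
  by rewrite -(scale_half (w ** t)) -{1}vtw vw cmulNr addNr scaler0.
have t0 : t = 0.
  apply: sa_sqr_eq0; first exact: spos_sa.
  by apply/eqP; rewrite -oppr_eq0 -cmulNl -wE -cmulA wt cmul0r.
apply: sa_sqr_eq0 => //; apply: sa_sqr_eq0; first exact: sa_sqr.
by rewrite cmulA -tE t0 cmul0l.
Qed.

(** p + q and p' + q' both square to h^2, where h is the common difference. *)
Lemma jordan_unique (p q p' q' : A) :
  cpositive p -> cpositive q -> cpositive p' -> cpositive q' ->
  p ** q = 0 -> p' ** q' = 0 -> p - q = p' - q' -> p = p'.
Proof.
have pos x : cpositive x -> spos x by move=> [y ->]; exact: spos_starM.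
move=> /pos pp /pos pq /pos pp' /pos pq' pq0 p'q'0 E.
have sqE u v : spos u -> spos v -> u ** v = 0 ->
    (u + v) ** (u + v) = (u - v) ** (u - v).
  move=> pu pv uv; have vu : v ** u = 0.
    by rewrite -(spos_sa pu) -(spos_sa pv) -starM uv star0.
  by rewrite cmulBl !cmulBr !cmulDl !cmulDr uv vu addr0 add0r subr0 sub0r opprK.
have D : p + q = p' + q'.
  apply: spos_sqr_inj; try exact: spos_add.
  by rewrite (sqE p q)// (sqE p' q')// E.
have DD : (p + q) + (p - q) = (p' + q') + (p' - q') by rewrite D E.
rewrite -(scale_half p) -(scale_half p'); congr (_ *: _).
by move: DD; rewrite (addrACA p) (addrACA p') !subrr !addr0.
Qed.

Lemma alg_orth_sa x y : self_adjoint x -> self_adjoint y ->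
  alg_orth x y <-> x ** y = 0.
Proof. by move=> sx sy; rewrite /alg_orth sx sy; split => [[]|]. Qed.

Lemma orth_lower_bound_unique_exists (a b : A) : self_adjoint a -> self_adjoint b ->
  exists! c : A, self_adjoint c /\
     (c <=* a /\ c <=* b) /\ alg_orth (a - c) (b - c).
Proof.
move=> sa sb; have [p [q [pp pq pq0 E]]] := jordan_exists (saB sa sb).
have pE : a - (a - p) = p by rewrite subKr.
have qE : b - (a - p) = q by rewrite opprB addrA addrAC -(opprB a) E opprB subrK.
exists (a - p); split.
  split; first by apply: saB => //; exact: spos_sa.
  split; first by rewrite /cle pE qE; split; exact: spos_cpositive.
  by rewrite pE qE; apply/alg_orth_sa => //; exact: spos_sa.
move=> c [sc [[ca cb] /alg_orth_sa orth]].
suff -> : p = a - c by rewrite subKr.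
apply: (jordan_unique (q := q) (q' := b - c)) => //; try exact: spos_cpositive.
  by apply: orth; exact: saB.
by rewrite -E opprB addrA subrK.
Qed.

End Jordan.

Theorem theorem2p4 (R : realType) (A : cstarAlgType R) (a b : A)
    (ha : self_adjoint a) (hb : self_adjoint b) :
  (exists! c : A, self_adjoint c /\
     (c <=* a /\ c <=* b) /\ alg_orth (a - c) (b - c)) /\
  (exists! d : A, self_adjoint d /\
     (a <=* d /\ b <=* d) /\ alg_orth (d - a) (d - b)).
Proof.
split; first exact: orth_lower_bound_unique_exists.
have swap u v : - u - - v = v - u :> A by rewrite opprK addrC.
have [c [[sc [[ca cb] orth]] cuniq]] :=
  orth_lower_bound_unique_exists (saN ha) (saN hb).
exists (- c); split.
  split; first exact: saN.
  by rewrite /cle ![- c - _]addrC.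
move=> d [sd [[ad bd] orth']]; apply/eqP; rewrite eqr_oppLR; apply/eqP.
apply: cuniq; split; first exact: saN.
by rewrite /cle !swap.
Qed.
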